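(* Let $a,b,c,d\in\mathbb C$ with $ad-bc\neq 0$, and let $I\subseteq \mathbb R$ be an open interval. The nonlinear evolution equation $$w_t = w_{xxx} - 3\,\frac{w_x w_{xx}}{w}\qquad (\mathrm{E})$$ is invariant under the transformation $$\hat w^2 = \frac{ad-bc}{\bigl(c\,D^{-1}(w^2)+d\bigr)^2}\,w^2 ,\qquad D^{-1}:=\int_{-\infty}^x d\xi .$$ That is: if $w$ is a nowhere vanishing solution of (E) on $\mathbb R\times I$, rapidly decreasing in $x$, such that $c\,D^{-1}(w^2)+d$ vanishes nowhere on $\mathbb R\times I$, and $\hat w:\mathbb R\times I\to\mathbb C$ is a smooth function satisfying the displayed relation, then $\hat w$ is also a solution of (E), i.e. $\hat w_t = \hat w_{xxx} - 3\,\hat w_x\hat w_{xx}/\hat w$.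
   Context: Functions depend on the real variables $(x,t)$, may be complex valued, and subscripts denote partial derivatives. $D^{-1}(w^2)(x,t)=\int_{-\infty}^x w(\xi,t)^2\,d\xi$. ''Rapidly decreasing in $x$'' means that $w(\cdot,t)$ belongs to the Schwartz space $S(\mathbb R)$ for each $t\in I$ and that $t\mapsto w(\cdot,t)\in S(\mathbb R)$ is a smooth curve; in particular $D^{-1}(w^2)$ is well defined. *)

(* Defs.v *)
(* Stdlib reals with Coquelicot. *)
From Stdlib Require Import Reals.
From Coquelicot Require Import Coquelicot.
Open Scope R_scope.

(* Unbounded intervals are included through the extended endpoints. *)
Definition Rbar_open_interval (alpha beta : Rbar) (t : R) : Prop :=
  Rbar_lt alpha t /\ Rbar_lt t beta.

(* Coquelicot's [C_derive] is the complex derivative of maps [C -> C]; maps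
   [R -> C] are differentiated through their real and imaginary parts.
   [Derive] is total, so [CDerive f x] is meaningful only when [f] is
   differentiable at [x]. *)
Definition CDerive (f : R -> C) (x : R) : C :=
  (Derive (fun y => Re (f y)) x, Derive (fun y => Im (f y)) x).

Definition CDerive_n (f : R -> C) (k : nat) (x : R) : C :=
  (Derive_n (fun y => Re (f y)) k x, Derive_n (fun y => Im (f y)) k x).

Definition ex_CDerive (f : R -> C) (x : R) : Prop :=
  ex_derive (fun y => Re (f y)) x /\ ex_derive (fun y => Im (f y)) x.

Definition ex_CDerive_n (f : R -> C) (k : nat) (x : R) : Prop :=
  ex_derive_n (fun y => Re (f y)) k x /\ ex_derive_n (fun y => Im (f y)) k x.

(* Functions of [(x, t)] are curried as [f x t]. *)
Definition Dx (f : R -> R -> C) (x t : R) : C := CDerive (fun y => f y t) x.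
Definition Dt (f : R -> R -> C) (x t : R) : C := CDerive (fun s => f x s) t.

(* C^n on the strip R x I. As I is open, the values of [f] outside the strip do
   not affect [Dx f] and [Dt f] on it. *)
Fixpoint C_n_on (n : nat) (I : R -> Prop) (f : R -> R -> C) : Prop :=
  (forall x t : R, I t ->
     @continuous (prod_UniformSpace R_UniformSpace R_UniformSpace) C_UniformSpace
       (fun p => f (fst p) (snd p)) (x, t)) /\
  match n with
  | O => True
  | S m =>
      (forall x t : R, I t ->
         ex_CDerive (fun y => f y t) x /\ ex_CDerive (fun s => f x s) t) /\
      C_n_on m I (Dx f) /\ C_n_on m I (Dt f)
  end.

Definition smooth_on (I : R -> Prop) (f : R -> R -> C) : Prop :=
  forall n : nat, C_n_on n I f.

Definition Schwartz (f : R -> C) : Prop :=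
  (forall (k : nat) (x : R), ex_CDerive_n f k x) /\
  (forall j k : nat, exists M : R,
     forall x : R, Rabs x ^ j * Cmod (CDerive_n f k x) <= M).

(* [v] is the derivative at [t] of the curve [g] in the Frechet space S(R): the
   difference quotients converge to [v] for every seminorm
   sup_x |x|^j |f^(k)(x)|. *)
Definition is_Schwartz_derive (g : R -> R -> C) (t : R) (v : R -> C) : Prop :=
  forall (j k : nat) (eps : posreal),
    locally' t (fun s : R => forall x : R,
      Rabs x ^ j *
        Cmod (CDerive_n (fun y => ((g s y - g t y) / RtoC (s - t) - v y)%C) k x)
      <= eps).

(* [dg n] is the n-th derivative of the curve [g]. *)
Definition smooth_Schwartz_curve (I : R -> Prop) (g : R -> R -> C) : Prop :=
  exists dg : nat -> R -> R -> C,
    dg O = g /\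
    forall (n : nat) (t : R), I t ->
      Schwartz (dg n t) /\ is_Schwartz_derive (dg n) t (dg (S n) t).

Definition rapidly_decreasing (I : R -> Prop) (w : R -> R -> C) : Prop :=
  smooth_Schwartz_curve I (fun t x => w x t).

Definition Dinv (f : R -> R -> C) (x t : R) : C :=
  @RInt_gen C_R_CompleteNormedModule (fun xi => f xi t)
    (Rbar_locally m_infty) (at_point x).

(* The non-vanishing clause gives the quotient its meaning, division by 0 being
   total. *)
Definition solution (I : R -> Prop) (w : R -> R -> C) : Prop :=
  forall x t : R, I t ->
    w x t <> RtoC 0 /\
    Dt w x t =
      (Dx (Dx (Dx w)) x t
       - RtoC 3 * (Dx w x t * Dx (Dx w) x t / w x t))%C.

(* Main.v *)
(* Put [v = D^-1 (w^2)], so that [w^2 = v_x].  Integrating [(w^2)_t = (2 w w_xx - 4 w_x^2)_x]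
   from minus infinity gives [v_t = 2 w w_xx - 4 w_x^2]; differentiating [v]
   in [t] under the integral sign is justified by a bound on the integrand uniform
   with weight [1 / (1 + x^2)].  The relation for [what^2] then determines the
   logarithmic derivatives of [what] in [x] and [t] as those of [w / (c v + d)], hence
   [what_t / what], [what_x / what], [what_xx / what] and [what_xxx / what] as rational
   functions of [w], its [x]-derivatives and [c v + d], and the equation for [what] is
   a rational identity. *)
Require Import Defs.
From Stdlib Require Import Reals Lra FunctionalExtensionality.
From Coquelicot Require Import Coquelicot.
(* [Reals] exports another [Dx]. *)
Import Defs.

(** * Differentiation of maps from R to C *)

(** C is taken as a normed module over R, the setting of the general rules and of the fundamental
    theorem of calculus; [is_CDerive_iff] links this to the componentwise [CDerive]. *)
Definition is_CDerive (f : R -> C) (x : R) (l : C) : Prop :=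
  @is_derive R_AbsRing C_R_NormedModule f x l.

Lemma C_R_norm_Cmod (z : C) : @norm _ C_R_NormedModule z = Cmod z.
Proof.
  change (sqrt (Rabs (fst z) ^ 2 + Rabs (snd z) ^ 2) = Cmod z).
  now rewrite !pow2_abs.
Qed.

(** The projections are linear over R, which gives one direction; the other recombines [f] as
    [Re f * 1 + Im f * Ci]. *)
Lemma is_CDerive_iff (f : R -> C) (x : R) (l : C) :
  is_CDerive f x l <->
  is_derive (fun y => Re (f y)) x (Re l) /\ is_derive (fun y => Im (f y)) x (Im l).
Proof.
  unfold is_CDerive; split.
  - intros H; split.
    + apply (filterdiff_comp' f (fun z : C_R_NormedModule => Re z) x
               (fun y : R => @scal _ C_R_NormedModule y l) Re); [exact H|].
      apply filterdiff_linear; apply (is_linear_fst (U := R_NormedModule)).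
    + apply (filterdiff_comp' f (fun z : C_R_NormedModule => Im z) x
               (fun y : R => @scal _ C_R_NormedModule y l) Im); [exact H|].
      apply filterdiff_linear; apply (is_linear_snd (U := R_NormedModule)).
  - intros [H1 H2].
    pose proof (is_derive_plus _ _ _ _ _
      (is_derive_scal_l (V := C_R_NormedModule) _ _ _ (RtoC 1) H1)
      (is_derive_scal_l (V := C_R_NormedModule) _ _ _ Ci H2)) as H.
    replace l with (@plus C_R_NormedModule (@scal _ C_R_NormedModule (Re l) (RtoC 1))
                      (@scal _ C_R_NormedModule (Im l) Ci)).
    + revert H; apply is_derive_ext; intros y.
      apply injective_projections; simpl; unfold plus, scal; simpl;
        unfold mult; simpl; unfold Re, Im; ring.
    + apply injective_projections; simpl; unfold plus, scal; simpl;
        unfold mult; simpl; unfold Re, Im; ring.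
Qed.

Lemma CDerive_correct (f : R -> C) (x : R) :
  ex_CDerive f x -> is_CDerive f x (CDerive f x).
Proof.
  intros [H1 H2]; apply is_CDerive_iff; split; now apply Derive_correct.
Qed.

Lemma is_CDerive_unique (f : R -> C) (x : R) (l : C) :
  is_CDerive f x l -> CDerive f x = l.
Proof.
  intros [H1 H2]%is_CDerive_iff.
  apply injective_projections; now apply is_derive_unique.
Qed.

Lemma is_CDerive_ext (f g : R -> C) (x : R) (l : C) :
  (forall y, f y = g y) -> is_CDerive f x l -> is_CDerive g x l.
Proof. intros H; apply is_derive_ext, H. Qed.

Lemma is_CDerive_const (k : C) (x : R) : is_CDerive (fun _ => k) x (RtoC 0).
Proof. apply (is_derive_const (V := C_R_NormedModule)). Qed.

Lemma is_CDerive_plus (f g : R -> C) (x : R) (l m : C) :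
  is_CDerive f x l -> is_CDerive g x m ->
  is_CDerive (fun y => f y + g y)%C x (l + m)%C.
Proof. apply (is_derive_plus (V := C_R_NormedModule)). Qed.

Lemma is_CDerive_minus (f g : R -> C) (x : R) (l m : C) :
  is_CDerive f x l -> is_CDerive g x m ->
  is_CDerive (fun y => f y - g y)%C x (l - m)%C.
Proof. apply (is_derive_minus (V := C_R_NormedModule)). Qed.

(** C is only a real module here, so the product is differentiated in components, each a combination
    of real products. *)
Lemma is_CDerive_mult (f g : R -> C) (x : R) (l m : C) :
  is_CDerive f x l -> is_CDerive g x m ->
  is_CDerive (fun y => f y * g y)%C x (l * g x + f x * m)%C.
Proof.
  intros [F1 F2]%is_CDerive_iff [G1 G2]%is_CDerive_iff.
  apply is_CDerive_iff; unfold Cmult, Cplus, Re, Im in *; simpl; split.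
  - pose proof (is_derive_minus _ _ _ _ _ (is_derive_mult _ _ _ _ _ F1 G1 Rmult_comm)
      (is_derive_mult _ _ _ _ _ F2 G2 Rmult_comm)) as H.
    replace (fst l * fst (g x) - snd l * snd (g x) + (fst (f x) * fst m - snd (f x) * snd m))%R
      with (minus (plus (mult (fst l) (fst (g x))) (mult (fst (f x)) (fst m)))
             (plus (mult (snd l) (snd (g x))) (mult (snd (f x)) (snd m))));
      [exact H|].
    unfold minus, plus, opp, mult; simpl; ring.
  - pose proof (is_derive_plus _ _ _ _ _ (is_derive_mult _ _ _ _ _ F1 G2 Rmult_comm)
      (is_derive_mult _ _ _ _ _ F2 G1 Rmult_comm)) as H.
    match goal with |- is_derive _ _ ?r => match type of H with is_derive _ _ ?s =>
      replace r with s; [exact H|] end end.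
    unfold plus, mult; simpl; ring.
Qed.

(** With [f = u + i v], the inverse has components [u / (u^2 + v^2)] and [- v / (u^2 + v^2)], to
    which real differentiation applies. *)
Lemma is_CDerive_inv (f : R -> C) (x : R) (l : C) :
  f x <> RtoC 0 -> is_CDerive f x l ->
  is_CDerive (fun y => / f y)%C x (- l / f x ^ 2)%C.
Proof.
  intros Hf [F1 F2]%is_CDerive_iff; apply is_CDerive_iff.
  assert (Hn : fst (f x) ^ 2 + snd (f x) ^ 2 <> 0).
  { intros E; apply Hf; apply injective_projections; simpl; nra. }
  unfold Re, Im in *.
  set (u := fun y => fst (f y)) in *; set (v := fun y => snd (f y)) in *.
  assert (E : (- l / f x ^ 2)%C =
    (( fst l * (u x ^ 2 + v x ^ 2) - u x * (2 * u x * fst l + 2 * v x * snd l)) / (u x ^ 2 + v x ^ 2) ^ 2,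
     (- snd l * (u x ^ 2 + v x ^ 2) + v x * (2 * u x * fst l + 2 * v x * snd l)) / (u x ^ 2 + v x ^ 2) ^ 2)).
  { unfold u, v in *. destruct l as [l1 l2]; destruct (f x) as [a b]; simpl in *.
    unfold Cdiv, Cinv, Cmult, Copp; simpl.
    (* The denominator of the unfolded inverse: the squared modulus of [f x ^ 2], that is
       [(a^2 + b^2)^2]. *)
    assert ((a * (a * 1 - b * 0) - b * (a * 0 + b * 1)) * ((a * (a * 1 - b * 0) - b * (a * 0 + b * 1)) * 1) +
  (a * (a * 0 + b * 1) + b * (a * 1 - b * 0)) * ((a * (a * 0 + b * 1) + b * (a * 1 - b * 0)) * 1) <> 0).
    { replace (_ + _)%R with ((a * (a * 1) + b * (b * 1))^2) by ring.
      now apply pow_nonzero. }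
    f_equal; field; 
      (split; [contradict Hn; etransitivity; [|exact Hn] | contradict H; etransitivity; [|exact H]]; ring). }
  rewrite E; simpl fst; simpl snd; clear E.
  change (u x ^ 2 + v x ^ 2 <> 0) in Hn.
  split.
  - apply (is_derive_ext (fun y => u y / (u y ^ 2 + v y ^ 2))); [reflexivity|].
    replace (fst l) with (Derive u x) by now apply is_derive_unique.
    replace (snd l) with (Derive v x) by now apply is_derive_unique.
    auto_derive; [repeat split; try assumption; eexists; eassumption|].
    change (Derive (fun y => u y) x) with (Derive u x).
    change (Derive (fun y => v y) x) with (Derive v x).
    simpl; field; contradict Hn; etransitivity; [|exact Hn]; ring.
  - apply (is_derive_ext (fun y => - v y / (u y ^ 2 + v y ^ 2))); [reflexivity|].
    replace (fst l) with (Derive u x) by now apply is_derive_unique.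
    replace (snd l) with (Derive v x) by now apply is_derive_unique.
    auto_derive; [repeat split; try assumption; eexists; eassumption|].
    change (Derive (fun y => u y) x) with (Derive u x).
    change (Derive (fun y => v y) x) with (Derive v x).
    simpl; field; contradict Hn; etransitivity; [|exact Hn]; ring.
Qed.

Lemma is_CDerive_div (f g : R -> C) (x : R) (l m : C) :
  g x <> RtoC 0 -> is_CDerive f x l -> is_CDerive g x m ->
  is_CDerive (fun y => f y / g y)%C x ((l * g x - f x * m) / g x ^ 2)%C.
Proof.
  intros Hg Hf Hm.
  replace ((l * g x - f x * m) / g x ^ 2)%C with (l * / g x + f x * (- m / g x ^ 2))%C
    by (field; exact Hg).
  apply is_CDerive_mult; [|apply is_CDerive_inv]; assumption.
Qed.

Lemma is_CDerive_continuous (f : R -> C) (x : R) (l : C) :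
  is_CDerive f x l -> @continuous _ C_R_NormedModule f x.
Proof.
  intros H; apply (ex_derive_continuous (V := C_R_NormedModule)); now exists l.
Qed.

(** * Primitives normalised at minus infinity *)

Definition vanishes_at_minus_infinity (F : R -> C) : Prop :=
  forall eps : R, 0 < eps -> exists A : R, forall x : R, x < A -> Cmod (F x) < eps.

(** [atan x + PI / 2] is the integral of [1 / (1 + z^2)] up to [x], so this controls the tails of
    integrands dominated by that weight. *)
Lemma atan_plus_PI2_small (eps : R) :
  0 < eps -> exists A : R, forall x : R, x < A -> atan x + PI / 2 < eps.
Proof.
  intros He; pose proof PI2_1 as HP.
  pose proof (Rmin_l eps 1); pose proof (Rmin_r eps 1).
  assert (0 < Rmin eps 1) by (apply Rmin_pos; lra).
  (* Capping [eps] at 1, which is below [PI / 2], keeps the argument of [tan] in the range where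
     [atan] inverts it. *)
  exists (tan (Rmin eps 1 - PI / 2)); intros x Hx.
  apply atan_increasing in Hx; rewrite atan_tan in Hx; lra.
Qed.

Lemma is_RInt_inv_one_plus_sqr (M y x : R) :
  is_RInt (fun z => M * / (1 + z ^ 2)) y x (M * (atan x - atan y)).
Proof.
  apply (is_RInt_scal (V := R_NormedModule) (fun z => / (1 + z ^ 2)) _ _ M (atan x - atan y)).
  apply (is_RInt_derive atan (fun z => / (1 + z ^ 2))); intros z _.
  - apply is_derive_Reals, derivable_pt_lim_atan.
  - apply (ex_derive_continuous (V := R_NormedModule)); auto_derive; nra.
Qed.

(** The increment is the integral of [f], and the dominating weight has primitive [M * atan]. *)
Lemma increment_le_atan (F f : R -> C) (M y x : R) :
  (forall z, is_CDerive F z (f z)) ->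
  (forall z, @continuous _ C_R_NormedModule f z) ->
  (forall z, Cmod (f z) <= M * / (1 + z ^ 2)) ->
  y <= x -> Cmod (F x - F y)%C <= M * (atan x - atan y).
Proof.
  intros HF Hc Hf Hyx.
  rewrite <- C_R_norm_Cmod.
  apply (norm_RInt_le (V := C_R_NormedModule) f (fun z => M * / (1 + z ^ 2)) y x); trivial.
  - intros z _; rewrite C_R_norm_Cmod; apply Hf.
  - apply (is_RInt_derive (V := C_R_CompleteNormedModule) F f); intros z _; [apply HF|apply Hc].
  - apply is_RInt_inv_one_plus_sqr.
Qed.

(** Let [y] go to minus infinity in [increment_le_atan]; increments of [atan] stay below [PI]. *)
Lemma Cmod_le_of_derivative (F f : R -> C) (M x : R) :
  (forall z, is_CDerive F z (f z)) ->
  (forall z, @continuous _ C_R_NormedModule f z) ->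
  (forall z, Cmod (f z) <= M * / (1 + z ^ 2)) ->
  vanishes_at_minus_infinity F -> Cmod (F x) <= M * PI.
Proof.
  intros HF Hc Hf H0; apply Rnot_lt_le; intros Hlt.
  (* The supposed excess over [M * PI] is the tolerance: far to the left [Cmod (F y)] is smaller
     than it, against the triangle inequality. *)
  destruct (H0 (Cmod (F x) - M * PI)) as [A HA]; [lra|].
  set (y := Rmin x (A - 1)).
  assert (y <= x) by apply Rmin_l.
  assert (y < A) by (pose proof (Rmin_r x (A - 1)); unfold y; lra).
  pose proof (increment_le_atan F f M y x HF Hc Hf H).
  specialize (HA y H1).
  pose proof (Cmod_triangle (F x - F y) (F y)) as HT.
  replace (F x - F y + F y)%C with (F x) in HT by ring.
  assert (0 <= M).
  { specialize (Hf 0); pose proof (Cmod_ge_0 (f 0)); rewrite pow_i, Rplus_0_r, Rinv_1 in Hf; [lra|auto]. }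
  pose proof (atan_bound x); pose proof (atan_bound y); nra.
Qed.

(** The integral from 0 is Cauchy at minus infinity by the [atan] bound; subtracting its limit there
    normalises it. *)
Lemma ex_primitive_vanishing (f : R -> C) (M : R) :
  (forall z, @continuous _ C_R_NormedModule f z) ->
  (forall z, Cmod (f z) <= M * / (1 + z ^ 2)) ->
  exists F : R -> C, (forall z, is_CDerive F z (f z)) /\ vanishes_at_minus_infinity F.
Proof.
  intros Hc Hf.
  set (G := fun x => @RInt C_R_CompleteNormedModule f 0 x : C).
  assert (HG : forall z, is_CDerive G z (f z)).
  { intros z; apply (is_derive_RInt (V := C_R_NormedModule) f G 0 z); [|apply Hc].
    apply filter_forall; intros b; apply (@RInt_correct C_R_CompleteNormedModule).
    apply (@ex_RInt_continuous C_R_CompleteNormedModule); intros; apply Hc. }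
  assert (HM : 0 <= M).
  { specialize (Hf 0); pose proof (Cmod_ge_0 (f 0)); rewrite pow_i, Rplus_0_r, Rinv_1 in Hf; [lra|auto]. }
  assert (Hsmall : forall eps : posreal, exists A, forall u v, u < A -> v < A ->
     Cmod (G u - G v)%C < eps).
  (* The division is by [M + 1] because [M] may be 0. *)
  { intros eps; destruct (atan_plus_PI2_small (eps / (M + 1))) as [A HA].
    { apply Rdiv_lt_0_compat; [apply cond_pos|lra]. }
    exists A.
    assert (Hle : forall u v, v <= u -> u < A -> Cmod (G u - G v)%C < eps).
    { intros u v Huv Hu.
      eapply Rle_lt_trans; [apply (increment_le_atan G f M v u HG Hc Hf Huv)|].
      specialize (HA u Hu); pose proof (atan_bound v).
      apply Rle_lt_trans with ((M + 1) * (atan u + PI / 2)).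
      - pose proof (atan_bound u); nra.
      - apply Rmult_lt_compat_l with (r := M + 1) in HA; [|lra].
        eapply Rlt_le_trans; [exact HA|right; field; lra]. }
    intros u v Hu Hv; destruct (Rle_lt_dec v u) as [H|H]; [auto|].
    replace (G u - G v)%C with (- (G v - G u))%C by ring.
    rewrite Cmod_opp; apply Hle; lra. }
  destruct (proj1 (filterlim_locally_cauchy (F := Rbar_locally m_infty)
              (G : R -> C_R_CompleteNormedModule))) as [l Hl].
  { intros eps; destruct (Hsmall eps) as [A HA]; exists (fun x => x < A); split.
    - now exists A.
    - intros u v Hu Hv; apply (norm_compat1 (V := C_R_NormedModule)).
      rewrite C_R_norm_Cmod; now apply HA. }
  exists (fun x => G x - l)%C; split.
  - intros z; replace (f z) with (f z - RtoC 0)%C by ring.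
    apply is_CDerive_minus; [apply HG|apply is_CDerive_const].
  - intros eps Heps.
    (* Convergence is expressed by balls of the uniform structure; [norm_factor] converts their
       radius into a bound on the norm. *)
    assert (He' : 0 < eps / @norm_factor _ C_R_NormedModule)
      by (apply Rdiv_lt_0_compat; [exact Heps|apply norm_factor_gt_0]).
    destruct (proj1 (filterlim_locally _ _) Hl (mkposreal _ He')) as [A HA].
    exists A; intros x Hx; specialize (HA x Hx).
    apply (norm_compat2 (V := C_R_NormedModule)) in HA.
    rewrite C_R_norm_Cmod in HA; simpl in HA.
    eapply Rlt_le_trans; [exact HA|right; field].
    apply Rgt_not_eq, norm_factor_gt_0.
Qed.

(** The integral from [y] to [x] is [F x - F y], and [F y] tends to 0; uniqueness of the improper
    integral does the rest. *)
Lemma Dinv_eq (f : R -> R -> C) (F : R -> C) (x t : R) :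
  (forall z, is_CDerive F z (f z t)) ->
  (forall z, @continuous _ C_R_NormedModule (fun y => f y t) z) ->
  vanishes_at_minus_infinity F -> Dinv f x t = F x.
Proof.
  intros HF Hc H0; unfold Dinv.
  apply (is_RInt_gen_unique (V := C_R_CompleteNormedModule) (fun xi => f xi t) (F x)).
  intros P [eps HP].
  destruct (H0 eps (cond_pos eps)) as [A HA].
  apply (Filter_prod _ _ _ (fun y => y < A) (fun y => y = x)); [now exists A|reflexivity|].
  intros y x' Hy ->; exists (F x - F y)%C; split.
  - apply (is_RInt_derive (V := C_R_CompleteNormedModule) F (fun y => f y t));
      intros z _; [apply HF|apply Hc].
  - apply HP; apply (norm_compat1 (V := C_R_NormedModule)); rewrite C_R_norm_Cmod.
    change (Cmod ((F x - F y) - F x)%C < eps).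
    replace ((F x - F y) - F x)%C with (- F y)%C by ring.
    rewrite Cmod_opp; now apply HA.
Qed.

(** * Multiples, squares and difference quotients *)

Lemma is_CDerive_scal (k : C) (f : R -> C) (x : R) (l : C) :
  is_CDerive f x l -> is_CDerive (fun y => k * f y)%C x (k * l)%C.
Proof.
  intros H; replace (k * l)%C with (RtoC 0 * f x + k * l)%C by ring.
  apply (is_CDerive_mult (fun _ => k)); [apply is_CDerive_const|exact H].
Qed.

Lemma is_CDerive_sqr (f : R -> C) (x : R) (l : C) :
  is_CDerive f x l -> is_CDerive (fun y => f y ^ 2)%C x (RtoC 2 * f x * l)%C.
Proof.
  intros H; apply (is_CDerive_ext (fun y => f y * f y)%C); [intros; simpl; ring|].
  replace (RtoC 2 * f x * l)%C with (l * f x + f x * l)%C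
    (* [ring] treats [RtoC 2] as an atom, hence the sum of ones. *)
    by (replace (RtoC 2) with (RtoC 1 + RtoC 1)%C by (rewrite <- RtoC_plus; reflexivity); ring).
  now apply is_CDerive_mult.
Qed.

(** Multiplying the quotient estimate by [Rabs (s - t)] gives the little-o condition; at [s = t],
    outside the punctured neighbourhood, that condition is trivial. *)
Lemma is_CDerive_of_quotients (f : R -> C) (t : R) (l : C) :
  (forall eps : R, 0 < eps -> locally' t (fun s : R =>
     Cmod ((f s - f t) / RtoC (s - t) - l)%C <= eps)) ->
  is_CDerive f t l.
Proof.
  intros H; split; [apply is_linear_scal_l|].
  intros x Hx.
  apply (is_filter_lim_locally_unique (V := AbsRing_NormedModule R_AbsRing)) in Hx.
  subst x; intros eps.
  specialize (H eps (cond_pos eps)); unfold locally', within in H; revert H; apply filter_imp.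
  intros s Hs.
  change (@norm _ C_R_NormedModule
            ((f s - f t) - @scal _ C_R_NormedModule (s - t)%R l)%C <= eps * Rabs (s - t)).
  replace (@scal _ C_R_NormedModule (s - t)%R l) with (RtoC (s - t) * l)%C.
  2:{ apply injective_projections; simpl; unfold scal; simpl; unfold mult; simpl; ring. }
  rewrite C_R_norm_Cmod.
  destruct (Req_dec s t) as [->|Hne].
  - replace (f t - f t - RtoC (t - t) * l)%C with (RtoC 0).
    + rewrite Cmod_0; apply Rmult_le_pos; [apply Rlt_le, cond_pos|apply Rabs_pos].
    + rewrite Rminus_diag; ring.
  - specialize (Hs Hne).
    assert (RtoC (s - t) <> RtoC 0) by (intros E; apply RtoC_inj in E; lra).
    replace (f s - f t - RtoC (s - t) * l)%C
      with (((f s - f t) / RtoC (s - t) - l) * RtoC (s - t))%C by (field; assumption).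
    rewrite Cmod_mult, Cmod_R.
    now apply Rmult_le_compat_r; [apply Rabs_pos|].
Qed.

(** * Decay and derivatives of Schwartz functions *)

Lemma vanishes_of_weighted_bound (F : R -> C) (M : R) :
  (forall x, Rabs x * Cmod (F x) <= M) -> vanishes_at_minus_infinity F.
Proof.
  (* To the left of this point [Rabs x * eps] exceeds [Rabs M], so [Cmod (F x) >= eps] would break
     the bound. *)
  intros H eps He; exists (- (Rabs M / eps + 1)); intros x Hx.
  assert (0 <= Rabs M / eps) by (apply Rdiv_le_0_compat; [apply Rabs_pos|lra]).
  specialize (H x); rewrite Rabs_left in H by lra.
  pose proof (Rle_abs M).
  assert (Rabs M = Rabs M / eps * eps) by (field; lra).
  apply Rnot_le_lt; intros Hle; nra.
Qed.

(** The sum of the seminorm bounds for [j = 0] and [j = 2] serves all three weights, since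
    [Rabs x <= 1 + x^2]. Weight [1 + x^2] is for integrability, weight [Rabs x] for limits at minus
    infinity. *)
Lemma Schwartz_bounds (f : R -> C) (k : nat) :
  Schwartz f -> exists B, 0 <= B /\ forall x,
    Cmod (CDerive_n f k x) <= B /\ (1 + x ^ 2) * Cmod (CDerive_n f k x) <= B /\
    Rabs x * Cmod (CDerive_n f k x) <= B.
Proof.
  intros [_ H].
  destruct (H 0%nat k) as [M0 H0]; destruct (H 2%nat k) as [M2 H2].
  exists (M0 + M2).
  assert (HH : forall x, 0 <= M0 /\ 0 <= M2 /\ Cmod (CDerive_n f k x) <= M0 /\
     x ^ 2 * Cmod (CDerive_n f k x) <= M2).
  { intros x; specialize (H0 x); specialize (H2 x); simpl pow at 1 in H0.
    rewrite pow2_abs in H2; pose proof (Cmod_ge_0 (CDerive_n f k x)).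
    pose proof (pow2_ge_0 x); repeat split; try lra; nra. }
  split; [destruct (HH 0); lra|].
  intros x; destruct (HH x) as (A1 & A2 & A3 & A4).
  pose proof (Cmod_ge_0 (CDerive_n f k x)); repeat split; try lra.
  assert (Rabs x <= 1 + x ^ 2)
    by (rewrite <- pow2_abs; pose proof (Rabs_pos x); nra).
  apply Rle_trans with ((1 + x ^ 2) * Cmod (CDerive_n f k x)); [|lra].
  now apply Rmult_le_compat_r.
Qed.

Lemma CDerive_n_0 (f : R -> C) (x : R) : CDerive_n f 0 x = f x.
Proof. now destruct (f x) eqn:E; unfold CDerive_n; simpl; rewrite E. Qed.

Lemma Schwartz_is_CDerive (f : R -> C) (k : nat) (x : R) :
  Schwartz f -> is_CDerive (CDerive_n f k) x (CDerive_n f (S k) x).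
Proof. intros [H _]; apply CDerive_correct, (H (S k)). Qed.

Lemma Schwartz_is_CDerive_0 (f : R -> C) (x : R) :
  Schwartz f -> is_CDerive f x (CDerive_n f 1 x).
Proof.
  intros H; apply (is_CDerive_ext (CDerive_n f 0)); [intros; apply CDerive_n_0|].
  now apply Schwartz_is_CDerive.
Qed.

Lemma Schwartz_sqr_continuous (f : R -> C) (x : R) :
  Schwartz f -> @continuous _ C_R_NormedModule (fun y => f y ^ 2)%C x.
Proof.
  intros H; eapply is_CDerive_continuous, is_CDerive_sqr, Schwartz_is_CDerive_0, H.
Qed.

(** * The primitive of a square and its derivative in the parameter *)

(** One factor of the square is at most [B], the other at most [B / (1 + x^2)]; so a normalised
    primitive exists, and [Dinv_eq] identifies it. *)
Lemma Dinv_sqr_primitive (f : R -> R -> C) (t : R) :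
  Schwartz (fun x => f x t) ->
  (forall x, is_CDerive (fun y => Dinv (fun x t => f x t ^ 2)%C y t) x (f x t ^ 2)%C) /\
  vanishes_at_minus_infinity (fun x => Dinv (fun x t => f x t ^ 2)%C x t).
Proof.
  intros H.
  destruct (Schwartz_bounds _ 0 H) as (B & HB & Hb).
  destruct (ex_primitive_vanishing (fun x => f x t ^ 2)%C (B * B)) as (F & HF & HF0).
  - intros z; apply (Schwartz_sqr_continuous (fun x => f x t)), H.
  - intros z; specialize (Hb z); rewrite CDerive_n_0 in Hb; destruct Hb as (b1 & b2 & _).
    rewrite Cmod_pow; pose proof (Cmod_ge_0 (f z t)).
    assert (0 < 1 + z ^ 2) by (pose proof (pow2_ge_0 z); lra).
    apply Rmult_le_reg_r with (1 + z ^ 2); trivial.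
    rewrite Rmult_assoc, Rinv_l, Rmult_1_r by lra.
    replace (Cmod (f z t) ^ 2 * (1 + z ^ 2)) with (Cmod (f z t) * ((1 + z ^ 2) * Cmod (f z t))) by ring.
    apply Rmult_le_compat; trivial; nra.
  - assert (E : forall x, Dinv (fun x t => f x t ^ 2)%C x t = F x).
    { intros x; apply Dinv_eq; trivial.
      intros z; apply (Schwartz_sqr_continuous (fun x => f x t)), H. }
    split.
    + intros x; apply (is_CDerive_ext F); [intros; symmetry; apply E|apply HF].
    + intros eps He; destruct (HF0 eps He) as [A HA]; exists A; intros x Hx.
      rewrite E; auto.
Qed.

(* With [D] the difference quotient of the curve, the integrand of the quotient
   minus [2 f v] is [(D - v) (2 f + (s - t) D) + v (s - t) D], which is at most
   [e K / (1 + x ^ 2)] once [s] is close to [t]. *)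
Lemma Dinv_sqr_derive_parameter (f : R -> R -> C) (I : R -> Prop) (t : R)
    (v G : R -> C) (x : R) :
  locally t I -> I t ->
  (forall s, I s -> Schwartz (fun y => f y s)) -> Schwartz v ->
  is_Schwartz_derive (fun s y => f y s) t v ->
  (forall y, is_CDerive G y (RtoC 2 * f y t * v y)%C) ->
  vanishes_at_minus_infinity G ->
  is_CDerive (fun s => Dinv (fun y s => f y s ^ 2)%C x s) t (G x).
Proof.
  intros HI It Hf Hv Hd HG HG0.
  apply is_CDerive_of_quotients; intros eps Heps.
  destruct (Schwartz_bounds _ 0 (Hf t It)) as (B1 & HB1 & Hb1).
  destruct (Schwartz_bounds _ 0 Hv) as (B2 & HB2 & Hb2).
  (* The two summands bound the two products in the decomposition of the integrand, after weighting
     by [1 + z^2] and division by [e]. *)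
  set (K := 2 * (2 * B1 + B2 + 1) + B2 * (B2 + 1)).
  assert (HK : 0 < K) by (unfold K; nra).
  pose proof PI_RGT_0 as HPI.
  (* The cap 1 gives [Cmod (D z) <= B2 + 1]; the other entry makes [e * K * PI], the bound from
     [Cmod_le_of_derivative], at most [eps]. *)
  set (e := Rmin 1 (eps / (K * PI))).
  assert (He : 0 < e).
  { apply Rmin_pos; [lra|]; apply Rdiv_lt_0_compat; [lra|]; now apply Rmult_lt_0_compat. }
  assert (He1 : e <= 1) by apply Rmin_l.
  assert (HeK : e * K * PI <= eps).
  { assert (e <= eps / (K * PI)) by apply Rmin_r.
    apply Rmult_le_compat_r with (r := K * PI) in H; [|nra].
    replace (eps / (K * PI) * (K * PI)) with eps in H by (field; lra); lra. }
  assert (Hball : locally t (fun s => Rabs (s - t) < e)).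
  { exists (mkposreal e He); intros s Hs; exact Hs. }
  (* The seminorms with [j = 0] and [j = 2] add up to weight [1 + x^2], whence the factor [2 * e]
     below. *)
  pose proof (Hd 0%nat 0%nat (mkposreal e He)) as D0.
  pose proof (Hd 2%nat 0%nat (mkposreal e He)) as D2.
  unfold locally', within in *.
  generalize (filter_and _ _ HI (filter_and _ _ Hball (filter_and _ _ D0 D2))).
  apply filter_imp; clear D0 D2 Hball HI; intros s (Is & Hs & D0 & D2) Hne.
  specialize (D0 Hne); specialize (D2 Hne); simpl pos in D0, D2.
  assert (Hst : RtoC (s - t) <> RtoC 0) by (intros E; apply RtoC_inj in E; lra).
  set (D := fun y => ((f y s - f y t) / RtoC (s - t))%C).
  set (h := fun y => ((f y s ^ 2 - f y t ^ 2) * / RtoC (s - t) - RtoC 2 * f y t * v y)%C).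
  destruct (Dinv_sqr_primitive f s (Hf s Is)) as [Fs Fs0].
  destruct (Dinv_sqr_primitive f t (Hf t It)) as [Ft Ft0].
  eapply Rle_trans; [|exact HeK].
  (* The error of the difference quotient is itself a primitive, of [h], vanishing at minus
     infinity; so a bound on [h] suffices. *)
  apply (Cmod_le_of_derivative (fun x => (Dinv (fun y s => f y s ^ 2)%C x s
     - Dinv (fun y s => f y s ^ 2)%C x t) / RtoC (s - t) - G x)%C h).
  - intros z; unfold h; apply is_CDerive_minus; [|apply HG].
    apply (is_CDerive_ext (fun y => / RtoC (s - t) * (Dinv (fun y s => f y s ^ 2)%C y s
     - Dinv (fun y s => f y s ^ 2)%C y t))%C); [intros; unfold Cdiv; ring|].
    rewrite Cmult_comm.
    apply is_CDerive_scal, is_CDerive_minus; [apply Fs|apply Ft].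
  - intros z; unfold h; eapply is_CDerive_continuous, is_CDerive_minus.
    + apply is_CDerive_mult; [apply is_CDerive_minus|apply is_CDerive_const];
        apply is_CDerive_sqr.
      * apply (Schwartz_is_CDerive_0 (fun y => f y s)), Hf, Is.
      * apply (Schwartz_is_CDerive_0 (fun y => f y t)), Hf, It.
    + apply is_CDerive_mult; [apply is_CDerive_scal|now apply Schwartz_is_CDerive_0].
      apply (Schwartz_is_CDerive_0 (fun y => f y t)), Hf, It.
  - intros z.
    specialize (Hb1 z); specialize (Hb2 z); specialize (D0 z); specialize (D2 z).
    rewrite CDerive_n_0 in Hb1, Hb2, D0, D2.
    fold (D z) in D0, D2; rewrite pow2_abs in D2; simpl pow at 1 in D0.
    assert (Hh : h z = ((D z - v z) * (RtoC 2 * f z t + RtoC (s - t) * D z)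
                        + v z * (RtoC (s - t) * D z))%C).
    { unfold h, D.
      replace (RtoC 2) with (RtoC 1 + RtoC 1)%C by (rewrite <- RtoC_plus; reflexivity).
      field; exact Hst. }
    assert (HDv : Cmod (D z) <= B2 + 1).
    { replace (D z) with ((D z - v z) + v z)%C by ring.
      eapply Rle_trans; [apply Cmod_triangle|]; lra. }
    assert (HsD : Cmod (RtoC (s - t) * D z) <= e * (B2 + 1)).
    { rewrite Cmod_mult, Cmod_R; apply Rmult_le_compat; try lra;
        [apply Rabs_pos|apply Cmod_ge_0]. }
    assert (Hsum : Cmod (RtoC 2 * f z t + RtoC (s - t) * D z) <= 2 * B1 + B2 + 1).
    { eapply Rle_trans; [apply Cmod_triangle|].
      rewrite Cmod_mult, Cmod_R, (Rabs_pos_eq 2) by lra; nra. }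
    assert (Hz : 0 < 1 + z ^ 2) by (pose proof (pow2_ge_0 z); lra).
    apply Rmult_le_reg_l with (1 + z ^ 2); trivial.
    replace ((1 + z ^ 2) * (e * K * / (1 + z ^ 2))) with (e * K) by (field; lra).
    rewrite Hh.
    apply Rle_trans with
      ((1 + z ^ 2) * Cmod (D z - v z) * Cmod (RtoC 2 * f z t + RtoC (s - t) * D z)
       + (1 + z ^ 2) * Cmod (v z) * Cmod (RtoC (s - t) * D z)).
    { rewrite 2!Rmult_assoc, <- Rmult_plus_distr_l, <- 2!Cmod_mult.
      apply Rmult_le_compat_l; [lra|apply Cmod_triangle]. }
    pose proof (Cmod_ge_0 (D z - v z)); pose proof (Cmod_ge_0 (v z)).
    apply Rle_trans with ((2 * e) * (2 * B1 + B2 + 1) + B2 * (e * (B2 + 1)));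
      [|unfold K; lra].
    apply Rplus_le_compat; apply Rmult_le_compat; try apply Cmod_ge_0; try assumption;
      try apply Hb2; nra.
  (* Here [s] is fixed and distinct from [t], so division by [s - t] only rescales the tolerances: a
     third of [eta] for each of the three terms. *)
  - intros eta Heta.
    assert (Hp : 0 < Rabs (s - t)) by (apply Rabs_pos_lt; lra).
    destruct (Fs0 (eta / 3 * Rabs (s - t))) as [A1 HA1]; [nra|].
    destruct (Ft0 (eta / 3 * Rabs (s - t))) as [A2 HA2]; [nra|].
    destruct (HG0 (eta / 3)) as [A3 HA3]; [lra|].
    exists (Rmin A1 (Rmin A2 A3)); intros y Hy.
    pose proof (Rmin_l A1 (Rmin A2 A3)); pose proof (Rmin_r A1 (Rmin A2 A3)).
    pose proof (Rmin_l A2 A3); pose proof (Rmin_r A2 A3).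
    specialize (HA1 y ltac:(lra)); specialize (HA2 y ltac:(lra)); specialize (HA3 y ltac:(lra)).
    eapply Rle_lt_trans; [apply Cmod_triangle|].
    rewrite Cmod_opp, Cmod_div, Cmod_R by exact Hst.
    assert (Cmod (Dinv (fun y s => f y s ^ 2)%C y s - Dinv (fun y s => f y s ^ 2)%C y t)%C
            < 2 * (eta / 3) * Rabs (s - t)).
    { eapply Rle_lt_trans; [apply Cmod_triangle|]; rewrite Cmod_opp; lra. }
    apply Rmult_lt_compat_r with (r := / Rabs (s - t)) in H3; [|now apply Rinv_0_lt_compat].
    rewrite Rmult_assoc, Rinv_r in H3 by lra.
    unfold Rdiv at 1; lra.
Qed.

(** * Logarithmic derivatives *)

(* Taking squares removes the sign ambiguity of [W]: its logarithmic derivative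
   is that of [f / q]. *)
Lemma is_CDerive_of_sqr_eq (K : C) (W f q : R -> C) (x : R) (f' q' : C) :
  K <> RtoC 0 -> f x <> RtoC 0 -> q x <> RtoC 0 ->
  locally x (fun y => (W y ^ 2)%C = (K / q y ^ 2 * f y ^ 2)%C) ->
  ex_CDerive W x -> is_CDerive f x f' -> is_CDerive q x q' ->
  W x <> RtoC 0 /\ is_CDerive W x (W x * (f' / f x - q' / q x))%C.
Proof.
  intros HK Hf Hq HW ExW Hf' Hq'.
  pose proof (locally_singleton _ _ HW) as E; cbv beta in E.
  assert (H2 : RtoC 2 <> RtoC 0) by (intros H; apply RtoC_inj in H; lra).
  (* A zero of [W] would force [K = 0], as [K = W^2 q^2 / f^2] at [x]. *)
  assert (HWx : W x <> RtoC 0).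
  { intros H0; rewrite H0 in E.
    assert (K = RtoC 0); [|contradiction].
    transitivity (RtoC 0 ^ 2 * q x ^ 2 / f x ^ 2)%C; [rewrite E|]; field; auto. }
  split; [exact HWx|].
  pose proof (CDerive_correct _ _ ExW) as HD.
  pose proof (is_CDerive_sqr _ _ _ HD) as H1.
  assert (H3 : is_CDerive (fun y => W y ^ 2)%C x
                 (RtoC 2 * W x ^ 2 * (f' / f x - q' / q x))%C).
  { apply (is_derive_ext_loc (V := C_R_NormedModule)
             (fun y => K * (f y ^ 2 / q y ^ 2))%C).
    - revert HW; apply filter_imp; intros y ->.
      change (K * (f y ^ 2 / q y ^ 2) = K / q y ^ 2 * f y ^ 2)%C; unfold Cdiv; ring.
    - rewrite E.
      replace (RtoC 2 * (K / q x ^ 2 * f x ^ 2) * (f' / f x - q' / q x))%C with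
        (K * ((RtoC 2 * f x * f' * q x ^ 2 - f x ^ 2 * (RtoC 2 * q x * q'))
              / (q x ^ 2) ^ 2))%C by (field; auto).
      apply is_CDerive_scal, is_CDerive_div; [|now apply is_CDerive_sqr..].
      replace (q x ^ 2)%C with (q x * q x)%C by ring.
      now apply Cmult_neq_0. }
  (* Two expressions for the derivative of [W^2] are equated; dividing by [2 W x] isolates that of
     [W]. *)
  apply is_CDerive_unique in H1; rewrite (is_CDerive_unique _ _ _ H3) in H1.
  replace (W x * (f' / f x - q' / q x))%C with (CDerive W x); [exact HD|].
  transitivity ((RtoC 2 * W x * CDerive W x) / (RtoC 2 * W x))%C;
    [|rewrite <- H1]; field; auto.
Qed.

(** If [W' = W L] then [(W P)' = W (L P + P')]; this is applied to [P = L] and then to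
    [P = L^2 + L1]. The hypotheses hold at every [y] because each formula is differentiated
    again. *)
Lemma third_derivative_log (W L L1 L2 : R -> C) (x : R) :
  (forall y, is_CDerive W y (W y * L y)%C) ->
  (forall y, is_CDerive L y (L1 y)) ->
  (forall y, is_CDerive L1 y (L2 y)) ->
  CDerive W x = (W x * L x)%C /\
  CDerive (CDerive W) x = (W x * (L x ^ 2 + L1 x))%C /\
  CDerive (CDerive (CDerive W)) x =
    (W x * (L x ^ 3 + RtoC 3 * L x * L1 x + L2 x))%C.
Proof.
  intros HW HL HL1.
  assert (E2 : RtoC 2 = (RtoC 1 + RtoC 1)%C) by (rewrite <- RtoC_plus; reflexivity).
  assert (E3 : RtoC 3 = (RtoC 1 + RtoC 1 + RtoC 1)%C)
    by (rewrite <- !RtoC_plus; f_equal; ring).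
  assert (D1 : forall y, CDerive W y = (W y * L y)%C)
    by (intros; apply is_CDerive_unique, HW).
  assert (H2 : forall y, is_CDerive (CDerive W) y (W y * (L y ^ 2 + L1 y))%C).
  { intros y; apply (is_CDerive_ext (fun y => W y * L y)%C); [now intros; rewrite D1|].
    replace (W y * (L y ^ 2 + L1 y))%C with (W y * L y * L y + W y * L1 y)%C by ring.
    now apply is_CDerive_mult. }
  assert (D2 : forall y, CDerive (CDerive W) y = (W y * (L y ^ 2 + L1 y))%C)
    by (intros; apply is_CDerive_unique, H2).
  split; [apply D1|split; [apply D2|]].
  apply is_CDerive_unique.
  apply (is_CDerive_ext (fun y => W y * (L y ^ 2 + L1 y))%C); [now intros; rewrite D2|].
  replace (W x * (L x ^ 3 + RtoC 3 * L x * L1 x + L2 x))%C with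
    (W x * L x * (L x ^ 2 + L1 x) + W x * (RtoC 2 * L x * L1 x + L2 x))%C
    by (rewrite E2, E3; ring).
  apply is_CDerive_mult; [apply HW|].
  apply is_CDerive_plus; [now apply is_CDerive_sqr|apply HL1].
Qed.

(** * Evolution in [t] of [w] and of the primitive of its square *)

Lemma locally_Rbar_open_interval (alpha beta : Rbar) (t : R) :
  Rbar_open_interval alpha beta t -> locally t (Rbar_open_interval alpha beta).
Proof.
  intros [Ha Hb]; apply filter_and.
  - apply (open_Rbar_gt' t alpha Ha).
  - apply (open_Rbar_lt' t beta Hb).
Qed.

(** Convergence in the seminorm [j = k = 0] is uniform in [x], so the derivative [dg 1] of the curve
    is the pointwise [Dt w], which thereby inherits the Schwartz property. *)
Lemma rapidly_decreasing_derive (I : R -> Prop) (w : R -> R -> C) (t : R) :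
  rapidly_decreasing I w -> I t ->
  Schwartz (fun x => w x t) /\ Schwartz (fun x => Dt w x t) /\
  is_Schwartz_derive (fun s x => w x s) t (fun x => Dt w x t) /\
  forall x, is_CDerive (fun s => w x s) t (Dt w x t).
Proof.
  intros (dg & E & H) It.
  destruct (H 0%nat t It) as [S0 D0]; destruct (H 1%nat t It) as [S1 _].
  rewrite E in S0, D0.
  assert (HD : forall x, is_CDerive (fun s => w x s) t (dg 1%nat t x)).
  { intros x; apply is_CDerive_of_quotients; intros eps He.
    pose proof (D0 0%nat 0%nat (mkposreal eps He)) as Hq; revert Hq.
    unfold locally', within; apply filter_imp; intros s Hs Hne.
    specialize (Hs Hne x); rewrite CDerive_n_0 in Hs; simpl in Hs.
    rewrite Rmult_1_l in Hs; exact Hs. }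
  assert (EQ : (fun x => Dt w x t) = dg 1%nat t)
    by (apply functional_extensionality; intros x; apply is_CDerive_unique, HD).
  rewrite EQ; split; [exact S0|split; [exact S1|split; [exact D0|]]].
  intros x; change (Dt w x t) with ((fun x => Dt w x t) x); rewrite EQ; apply HD.
Qed.

(** By (E), [2 w w_t = 2 w w_xxx - 6 w_x w_xx], the [x]-derivative of [2 w w_xx - 4 w_x^2]. This
    flux vanishes at minus infinity, so it can be the [G] of [Dinv_sqr_derive_parameter]. *)
Lemma Dinv_sqr_evolution (I : R -> Prop) (w : R -> R -> C) (x t : R) :
  locally t I -> I t -> solution I w -> rapidly_decreasing I w ->
  is_CDerive (fun s => Dinv (fun y s => w y s ^ 2)%C x s) t
    (RtoC 2 * w x t * Dx (Dx w) x t - RtoC 4 * Dx w x t ^ 2)%C.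
Proof.
  intros HI It Hs Hr.
  destruct (rapidly_decreasing_derive I w t Hr It) as (S0 & S1 & Hd & _).
  apply (Dinv_sqr_derive_parameter w I t (fun x => Dt w x t)
    (fun x => RtoC 2 * w x t * Dx (Dx w) x t - RtoC 4 * Dx w x t ^ 2)%C x); trivial.
  - intros s Is; now apply (rapidly_decreasing_derive I w s Hr).
  - intros y; destruct (Hs y t It) as [Hw ->].
    assert (E2 : RtoC 2 = (RtoC 1 + RtoC 1)%C) by (rewrite <- RtoC_plus; reflexivity).
    assert (E3 : RtoC 3 = (RtoC 1 + RtoC 2)%C)
      by (rewrite <- !RtoC_plus; f_equal; ring).
    assert (E4 : RtoC 4 = (RtoC 2 + RtoC 2)%C)
      by (rewrite <- !RtoC_plus; f_equal; ring).
    replace (RtoC 2 * w y t *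
      (Dx (Dx (Dx w)) y t - RtoC 3 * (Dx w y t * Dx (Dx w) y t / w y t)))%C with
      (RtoC 2 * Dx w y t * Dx (Dx w) y t + RtoC 2 * w y t * Dx (Dx (Dx w)) y t
       - RtoC 4 * (RtoC 2 * Dx w y t * Dx (Dx w) y t))%C
      by (rewrite E4, E3, E2; field; exact Hw).
    apply is_CDerive_minus.
    + apply (is_CDerive_mult (fun y => RtoC 2 * w y t)%C (fun y => Dx (Dx w) y t)).
      * apply is_CDerive_scal, (Schwartz_is_CDerive_0 _ y S0).
      * apply (Schwartz_is_CDerive _ 2 y S0).
    + apply is_CDerive_scal, (is_CDerive_sqr (fun y => Dx w y t)).
      apply (Schwartz_is_CDerive _ 1 y S0).
  - destruct (Schwartz_bounds _ 0 S0) as (B0 & HB0 & Hb0).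
    destruct (Schwartz_bounds _ 1 S0) as (B1 & HB1 & Hb1).
    destruct (Schwartz_bounds _ 2 S0) as (B2 & HB2 & Hb2).
    (* In each product one factor absorbs the weight [Rabs y] and the other is merely bounded. *)
    apply (vanishes_of_weighted_bound _ (2 * (B0 * B2) + 4 * (B1 * B1))); intros y.
    specialize (Hb0 y); specialize (Hb1 y); specialize (Hb2 y).
    rewrite CDerive_n_0 in Hb0.
    change (CDerive_n (fun x => w x t) 1 y) with (Dx w y t) in Hb1.
    change (CDerive_n (fun x => w x t) 2 y) with (Dx (Dx w) y t) in Hb2.
    pose proof (Cmod_ge_0 (w y t)); pose proof (Cmod_ge_0 (Dx w y t)).
    pose proof (Cmod_ge_0 (Dx (Dx w) y t)); pose proof (Rabs_pos y).
    apply Rle_trans with (2 * ((Rabs y * Cmod (w y t)) * Cmod (Dx (Dx w) y t))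
       + 4 * ((Rabs y * Cmod (Dx w y t)) * Cmod (Dx w y t))).
    + eapply Rle_trans;
        [apply Rmult_le_compat_l; [apply Rabs_pos|apply Cmod_triangle]|].
      rewrite Cmod_opp, !Cmod_mult, Cmod_pow, !Cmod_R, (Rabs_pos_eq 2), (Rabs_pos_eq 4) by lra.
      right; ring.
    + apply Rplus_le_compat; (apply Rmult_le_compat_l; [lra|]);
        apply Rmult_le_compat; try apply Rmult_le_pos; tauto.
Qed.

(** * Invariance of the equation *)

Theorem proposition2 (a b c d : C) (alpha beta : Rbar) (w what : R -> R -> C) :
  (a * d - b * c)%C <> RtoC 0 ->
  let I := Rbar_open_interval alpha beta in
  let v := Dinv (fun x t => (w x t ^ 2)%C) in
  solution I w ->
  rapidly_decreasing I w ->
  (forall x t : R, I t -> (c * v x t + d)%C <> RtoC 0) ->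
  smooth_on I what ->
  (forall x t : R, I t ->
     (what x t ^ 2)%C =
       ((a * d - b * c) / (c * v x t + d) ^ 2 * w x t ^ 2)%C) ->
  solution I what.
Proof.
  intros HK I v Hs Hr Hq Hsm HW x t It.
  pose proof (locally_Rbar_open_interval alpha beta t It) as HI.
  destruct (rapidly_decreasing_derive I w t Hr It) as (S0 & _ & _ & Ht).
  destruct (Dinv_sqr_primitive w t S0) as [Hv _].
  destruct (Hsm 1%nat) as [_ [Hex _]].
  set (q := fun x t => (c * v x t + d)%C).
  assert (Hadd : forall (h : R -> C) y l, is_CDerive h y l ->
            is_CDerive (fun z => c * h z + d)%C y (c * l)%C).
  { intros h y l H; replace (c * l)%C with (c * l + RtoC 0)%C by ring.
    apply is_CDerive_plus; [now apply is_CDerive_scal|apply is_CDerive_const]. }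
  assert (Hqx : forall y, is_CDerive (fun z => q z t) y (c * w y t ^ 2)%C)
    by (intros y; apply Hadd, Hv).
  pose proof (Hadd _ _ _ (Dinv_sqr_evolution I w x t HI It Hs Hr)) as Hqt.
  change (is_CDerive (fun s => q x s) t (c * (RtoC 2 * w x t * Dx (Dx w) x t - RtoC 4 * Dx w x t ^ 2))%C) in Hqt.
  (* The logarithmic [x]-derivative of [w / q], where [q_x = c w^2]. *)
  set (L := fun y => (Dx w y t / w y t - c * w y t ^ 2 / q y t)%C).
  assert (HWx : forall y, what y t <> RtoC 0 /\
                  is_CDerive (fun z => what z t) y (what y t * L y)%C).
  { intros y.
    apply (is_CDerive_of_sqr_eq (a * d - b * c) (fun z => what z t) (fun z => w z t)
             (fun z => q z t)); trivial.
    - apply (Hs y t It).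
    - apply (Hq y t It).
    - apply filter_forall; intros z; now apply HW.
    - apply (Hex y t It).
    - apply (Schwartz_is_CDerive_0 _ y S0). }
  (* In [t] the relation is available only on [I], hence near [t] because [I] is open. *)
  destruct (is_CDerive_of_sqr_eq (a * d - b * c) (fun s => what x s) (fun s => w x s)
    (fun s => q x s) t _ _ HK (proj1 (Hs x t It)) (Hq x t It)
    (filter_imp _ _ (fun s => HW x s) HI) (proj2 (Hex x t It)) (Ht x) Hqt) as [_ HWt].
  split; [apply HWx|].
  assert (Hw : forall y, w y t <> RtoC 0) by (intros y; apply (Hs y t It)).
  assert (Hq0 : forall y, q y t <> RtoC 0) by (intros y; apply (Hq y t It)).
  assert (D0 := fun y => Schwartz_is_CDerive_0 _ y S0).
  assert (D1 := fun y => Schwartz_is_CDerive _ 1 y S0).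
  assert (D2 := fun y => Schwartz_is_CDerive _ 2 y S0).
  change (forall y, is_CDerive (fun z => w z t) y (Dx w y t)) in D0.
  change (forall y, is_CDerive (fun z => Dx w z t) y (Dx (Dx w) y t)) in D1.
  change (forall y, is_CDerive (fun z => Dx (Dx w) z t) y (Dx (Dx (Dx w)) y t)) in D2.
  (* [L = A - M] with [A = w_x / w] and [M = q_x / q]. Their derivatives are kept in the Riccati
     forms [w_xx / w - A^2] and [q_xx / q - M^2], easy to differentiate once more. *)
  set (A := fun y => (Dx w y t / w y t)%C).
  set (M := fun y => (c * w y t ^ 2 / q y t)%C).
  assert (HA : forall y, is_CDerive A y (Dx (Dx w) y t / w y t - A y ^ 2)%C).
  { intros y; unfold A.
    replace (Dx (Dx w) y t / w y t - (Dx w y t / w y t) ^ 2)%C with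
      ((Dx (Dx w) y t * w y t - Dx w y t * Dx w y t) / w y t ^ 2)%C by (field; auto).
    apply (is_CDerive_div (fun z => Dx w z t) (fun z => w z t)); auto. }
  assert (HM : forall y, is_CDerive M y
    (RtoC 2 * c * (w y t * Dx w y t / q y t) - M y ^ 2)%C).
  { intros y; unfold M.
    replace (RtoC 2 * c * (w y t * Dx w y t / q y t) - (c * w y t ^ 2 / q y t) ^ 2)%C with
      ((c * (RtoC 2 * w y t * Dx w y t) * q y t - c * w y t ^ 2 * (c * w y t ^ 2))
       / q y t ^ 2)%C by (field; auto).
    apply (is_CDerive_div (fun z => c * w z t ^ 2)%C (fun z => q z t)); auto.
    apply is_CDerive_scal, (is_CDerive_sqr (fun z => w z t)), D0. }
  (* The placeholders for [L1] and [L2] are filled by unification with the derivatives built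
     here. *)
  destruct (third_derivative_log (fun z => what z t) L _ _ x
    (fun y => proj2 (HWx y))
    (fun y => is_CDerive_minus A M y _ _ (HA y) (HM y))
    (fun y => is_CDerive_minus (fun z => Dx (Dx w) z t / w z t - A z ^ 2)%C
       (fun z => RtoC 2 * c * (w z t * Dx w z t / q z t) - M z ^ 2)%C y _ _
       (is_CDerive_minus (fun z => Dx (Dx w) z t / w z t)%C _ y _ _
          (is_CDerive_div (fun z => Dx (Dx w) z t) (fun z => w z t) y _ _
             (Hw y) (D2 y) (D0 y))
          (is_CDerive_sqr A y _ (HA y)))
       (is_CDerive_minus (fun z => RtoC 2 * c * (w z t * Dx w z t / q z t))%C _ y _ _
          (is_CDerive_scal (RtoC 2 * c) (fun z => w z t * Dx w z t / q z t)%C y _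
             (is_CDerive_div (fun z => w z t * Dx w z t)%C (fun z => q z t) y _ _ (Hq0 y)
                (is_CDerive_mult (fun z => w z t) (fun z => Dx w z t) y _ _ (D0 y) (D1 y))
                (Hqx y)))
          (is_CDerive_sqr M y _ (HM y))))) as (E1 & E2 & E3).
  change (Dx what x t = (what x t * L x)%C) in E1.
  change (CDerive (CDerive (fun z => what z t)) x) with (Dx (Dx what) x t) in E2.
  change (CDerive (CDerive (CDerive (fun z => what z t))) x)
    with (Dx (Dx (Dx what)) x t) in E3.
  apply is_CDerive_unique in HWt; change (CDerive (fun s => what x s) t) with (Dt what x t) in HWt.
  (* In terms of [L], (E) for [what] reads [what_t / what = L'' - 2 L^3]; the left side is
     [w_t / w - q_t / q], with [w_t] taken from (E). *)
  rewrite HWt, E1, E2, E3, (proj2 (Hs x t It)); unfold L, A, M.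
  replace (RtoC 4) with (RtoC 2 + RtoC 2)%C by (rewrite <- RtoC_plus; f_equal; ring).
  replace (RtoC 3) with (RtoC 1 + RtoC 2)%C by (rewrite <- RtoC_plus; f_equal; ring).
  replace (RtoC 2) with (RtoC 1 + RtoC 1)%C by (rewrite <- RtoC_plus; f_equal; ring).
  destruct (HWx x) as [HW0 _]; specialize (Hw x); specialize (Hq0 x).
  field; auto.
Qed.
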